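(* Let $\lambda$ be a strict partition of length $r\le n$. Then (1) $P^{\mathbb L}_\lambda(x_1,\ldots,x_{n-1},0)=P^{\mathbb L}_\lambda(x_1,\ldots,x_{n-1})$, (2) $Q^{\mathbb L}_\lambda(x_1,\ldots,x_{n-1},0)=Q^{\mathbb L}_\lambda(x_1,\ldots,x_{n-1})$, where the right-hand sides are zero if $r=n$.
   Context: $\mathbb L$ is the Lazard ring with universal formal group law $F_{\mathbb L}(u,v)=u+v+\sum_{i,j\ge1}a_{i,j}u^iv^j$; $a+_Fb=F_{\mathbb L}(a,b)$ and $\overline a\in\mathbb L[[a]]$ is the formal inverse ($a+_F\overline a=0$). For a strict partition $\lambda=(\lambda_1>\cdots>\lambda_r>0)$ of length $r\le n$, $$P^{\mathbb L}_\lambda(x_1,\ldots,x_n)=\frac1{(n-r)!}\sum_{w\in S_n}w\Big[\prod_{i=1}^rx_i^{\lambda_i}\prod_{i=1}^r\prod_{j=i+1}^n\frac{x_i+_Fx_j}{x_i+_F\overline x_j}\Big],$$ $$Q^{\mathbb L}_\lambda(x_1,\ldots,x_n)=\frac1{(n-r)!}\sum_{w\in S_n}w\Big[\prod_{i=1}^r(x_i+_Fx_i)x_i^{\lambda_i-1}\prod_{i=1}^r\prod_{j=i+1}^n\frac{x_i+_Fx_j}{x_i+_F\overline x_j}\Big],$$ where $S_n$ permutes the variables $x_1,\ldots,x_n$. These are well-defined symmetric formal power series over $\mathbb L$. If $r>n$, both are defined to be $0$. *)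

(* Defs.v *)
From HB Require Import structures.
From mathcomp Require Import all_boot all_order all_algebra all_fingroup.
From mathcomp Require Import mpoly.
From mathcomp Require Import boolp classical_sets.

Set Implicit Arguments.
Unset Strict Implicit.
Unset Printing Implicit Defensive.

Import Order.TTheory GRing.Theory.
Local Open Scope ring_scope.

(* Formal power series in n commuting variables over R, given by their
   coefficients; the exponents are the multinomials 'X_{1..n} of mpoly. *)
Record mps (n : nat) (R : comNzRingType) := Mps { mpscoef : 'X_{1..n} -> R }.

Arguments Mps {n R}.

Notation "{ 'mps' R [ n ] }" := (mps n R)
  (R at level 2, n at level 2, format "{ 'mps'  R [ n ] }") : type_scope.

HB.instance Definition _ (n : nat) (R : comNzRingType) :=
  gen_eqMixin {mps R[n]}.
HB.instance Definition _ (n : nat) (R : comNzRingType) :=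
  gen_choiceMixin {mps R[n]}.

Section PowerSeriesRing.
Variables (n : nat) (R : comNzRingType).
Implicit Types (f g h : {mps R[n]}) (m : 'X_{1..n}).

Lemma mpsP f g : (forall m, mpscoef f m = mpscoef g m) -> f = g.
Proof. by case: f g => [f] [g] /= fg; congr Mps; apply/funext. Qed.

Definition mps_const (c : R) : {mps R[n]} :=
  Mps (fun m => if m == 0%MM then c else 0).
Definition mpsX (i : 'I_n) : {mps R[n]} :=
  Mps (fun m => (m == U_(i)%MM)%:R).
Definition mps_opp f : {mps R[n]} := Mps (fun m => - mpscoef f m).
Definition mps_add f g : {mps R[n]} := Mps (fun m => mpscoef f m + mpscoef g m).
Definition mps_mul f g : {mps R[n]} := Mps (fun m =>
  \sum_(k : 'X_{1..n < (mdeg m).+1, (mdeg m).+1} | m == (k.1 + k.2)%MM)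
    mpscoef f k.1 * mpscoef g k.2).

Lemma mps_addA : associative mps_add.
Proof. by move=> f g h; apply/mpsP => m; rewrite /= addrA. Qed.
Lemma mps_addC : commutative mps_add.
Proof. by move=> f g; apply/mpsP => m; rewrite /= addrC. Qed.
Lemma mps_add0 : left_id (mps_const 0) mps_add.
Proof. by move=> f; apply/mpsP => m; rewrite /= if_same add0r. Qed.
Lemma mps_addN : left_inverse (mps_const 0) mps_opp mps_add.
Proof. by move=> f; apply/mpsP => m; rewrite /= if_same addNr. Qed.

HB.instance Definition _ :=
  GRing.isZmodule.Build {mps R[n]} mps_addA mps_addC mps_add0 mps_addN.

Definition mps_trunc (d : nat) f : {mpoly R[n]} :=
  \sum_(k : 'X_{1..n < d}) mpscoef f k *: 'X_[k].

Lemma mps_truncE d f m : (mdeg m < d)%N -> (mps_trunc d f)@_m = mpscoef f m.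
Proof. exact: mcoeff_mpoly. Qed.

Lemma mps_mulE f g m (p q : {mpoly R[n]}) :
  (forall k, (mdeg k <= mdeg m)%N -> mpscoef f k = p@_k) ->
  (forall k, (mdeg k <= mdeg m)%N -> mpscoef g k = q@_k) ->
  mpscoef (mps_mul f g) m = (p * q)@_m.
Proof.
move=> fp gq; rewrite mcoeffM /=; apply: eq_bigr => k _.
by rewrite fp ?gq // -ltnS bmdeg.
Qed.

Lemma mps_mulT d f g m : (mdeg m < d)%N ->
  mpscoef (mps_mul f g) m = (mps_trunc d f * mps_trunc d g)@_m.
Proof.
by move=> md; apply: mps_mulE => k km; rewrite mps_truncE // (leq_ltn_trans km).
Qed.

Lemma mps_mulA : associative mps_mul.
Proof.
move=> f g h; apply/mpsP => m; pose d := (mdeg m).+1.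
rewrite (@mps_mulE f _ m (mps_trunc d f) (mps_trunc d g * mps_trunc d h)).
- rewrite mulrA; apply/esym/mps_mulE => k km; last by rewrite mps_truncE.
  by rewrite (@mps_mulT d).
- by move=> k km; rewrite mps_truncE.
- by move=> k km; rewrite (@mps_mulT d).
Qed.

Lemma mps_mulC : commutative mps_mul.
Proof.
move=> f g; apply/mpsP => m.
by rewrite !(@mps_mulT (mdeg m).+1) // mulrC.
Qed.

Lemma mps_mul1 : left_id (mps_const 1) mps_mul.
Proof.
move=> f; apply/mpsP => m.
rewrite (@mps_mulE _ _ m 1 (mps_trunc (mdeg m).+1 f)) ?mul1r ?mps_truncE //.
- by move=> k _; rewrite mcoeff1 /=; case: eqP.
- by move=> k km; rewrite mps_truncE.
Qed.

Lemma mps_mulDl : left_distributive mps_mul mps_add.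
Proof.
move=> f g h; apply/mpsP => m /=; rewrite -big_split /=.
by apply: eq_bigr => k _; rewrite mulrDl.
Qed.

Lemma mps_1neq0 : mps_const 1 != mps_const 0.
Proof.
by apply/eqP => /(congr1 (fun f => mpscoef f 0%MM)) /= /eqP; rewrite eqxx oner_eq0.
Qed.

HB.instance Definition _ := GRing.Zmodule_isComNzRing.Build {mps R[n]}
  mps_mulA mps_mulC mps_mul1 mps_mulDl mps_1neq0.

Definition mps_unit : {pred {mps R[n]}} :=
  fun f => `[< exists g, g * f = 1 >].
Definition mps_inv f : {mps R[n]} := xget f [set g | g * f = 1].

Lemma mps_mulV : {in mps_unit, left_inverse 1 mps_inv *%R}.
Proof.
move=> f /asboolP[g gf]; rewrite /mps_inv.
by case: xgetP => [h _ //|/(_ g)]; case.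
Qed.
Lemma mps_unitP f g : g * f = 1 -> mps_unit f.
Proof. by move=> gf; apply/asboolP; exists g. Qed.
Lemma mps_inv_out : {in [predC mps_unit], mps_inv =1 id}.
Proof.
move=> f /negP nf; rewrite /mps_inv.
by case: xgetP => // h _ /= hf; case: nf; apply: mps_unitP hf.
Qed.

HB.instance Definition _ := GRing.ComNzRing_hasMulInverse.Build {mps R[n]}
  mps_mulV mps_unitP mps_inv_out.

End PowerSeriesRing.

Arguments mpsX {n R}.

Section PowerSeriesDomain.
Variables (n : nat) (R : idomainType).
Implicit Types f g : {mps R[n]}.

Lemma mps_order f : f != 0 -> exists2 a : 'X_{1..n},
  mpscoef f a != 0 & forall b, (b < a)%O -> mpscoef f b = 0.
Proof.
move=> f0; apply: contrapT => nex; case/eqP: f0; apply/mpsP => m.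
rewrite [RHS]/= if_same.
elim/(@ltmwf n): m => a IH; apply: contrapT => /eqP fa.
by apply: nex; exists a.
Qed.

Lemma mps_integral : GRing.integral_domain_axiom {mps R[n]}.
Proof.
move=> f g fg; rewrite -[_ || _]negbK negb_or; apply/negP.
case/andP => /mps_order[a fa fa0] /mps_order[b gb gb0].
suff /eqP : mpscoef (f * g) (a + b)%MM = mpscoef f a * mpscoef g b.
  by rewrite fg [X in X == _]/= if_same eq_sym mulf_eq0 (negPf fa) (negPf gb).
have da : (mdeg a < (mdeg (a + b)%MM).+1)%N by rewrite mdegD ltnS leq_addr.
have db : (mdeg b < (mdeg (a + b)%MM).+1)%N by rewrite mdegD ltnS leq_addl.
rewrite [LHS]/= (bigD1 (BMultinom da, BMultinom db)) //= big1 ?addr0 //.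
case=> k l /= /andP[/eqP kl ne].
case: (ltgtP (k : 'X_{1..n}) a) => [ka|ak|ka].
- by rewrite fa0 ?mul0r.
- case: (leP b (l : 'X_{1..n})) => [bl|lb]; last by rewrite gb0 ?mulr0.
  by have := ltmc_le_add ak bl; rewrite -kl ltxx.
- case/eqP: ne; congr pair; apply/val_inj => //=.
  by move: kl; rewrite ka => /eqP; rewrite eqm_add2l => /eqP.
Qed.

HB.instance Definition _ :=
  GRing.ComUnitRing_isIntegral.Build {mps R[n]} mps_integral.

End PowerSeriesDomain.

(* The composite f(g_0, ..., g_{m-1}), for series g_i without constant term:
   then g^d has no monomial of degree < mdeg d, so that only the exponents d
   with mdeg d <= mdeg k contribute to the coefficient at k. *)
Definition mps_subst (R : comNzRingType) (m n : nat)
    (f : {mps R[m]}) (g : 'I_m -> {mps R[n]}) : {mps R[n]} :=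
  Mps (fun k => \sum_(d : 'X_{1..m < (mdeg k).+1})
    mpscoef f d * mpscoef (\prod_(i < m) g i ^+ d i) k).

Definition mps_map (R S : comNzRingType) (phi : {rmorphism R -> S}) (n : nat)
    (f : {mps R[n]}) : {mps S[n]} :=
  Mps (fun k => phi (mpscoef f k)).

Definition mps_last0 (R : comNzRingType) (n : nat) (f : {mps R[n.+1]}) :
    {mps R[n]} :=
  mps_subst f (fun i => if unlift ord_max i is Some j then mpsX j else 0).

Section FormalGroupLaw.
Variable R : comNzRingType.
Implicit Type F : {mps R[2]}.

Definition fgl_add F (n : nat) (a b : {mps R[n]}) : {mps R[n]} :=
  mps_subst F (fun i => if i == ord0 then a else b).

(* One-dimensional commutative formal group laws. *)
Definition is_fgl F : Prop :=
  [/\ fgl_add F (mpsX ord0) 0 = mpsX ord0 :> {mps R[1]},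
      fgl_add F 0 (mpsX ord0) = mpsX ord0 :> {mps R[1]},
      (let u : {mps R[2]} := mpsX ord0 in
       let v : {mps R[2]} := mpsX ord_max in
       fgl_add F u v = fgl_add F v u)
    & (let u : {mps R[3]} := mpsX ord0 in
       let v : {mps R[3]} := mpsX (inord 1) in
       let w : {mps R[3]} := mpsX ord_max in
       fgl_add F (fgl_add F u v) w = fgl_add F u (fgl_add F v w))].

Definition fgl_inv_series F : {mps R[1]} :=
  xget 0 [set chi : {mps R[1]} |
    mpscoef chi 0%MM = 0 /\ fgl_add F (mpsX ord0) chi = 0].

Definition fgl_opp F (n : nat) (a : {mps R[n]}) : {mps R[n]} :=
  mps_subst (fgl_inv_series F) (fun=> a).

End FormalGroupLaw.

(* L is a Lazard ring, with universal formal group law F. *)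
Definition universal_fgl (L : comNzRingType) (F : {mps L[2]}) : Prop :=
  is_fgl F /\
  forall (R : comNzRingType) (G : {mps R[2]}), is_fgl G ->
    (exists phi : {rmorphism L -> R}, mps_map phi F = G) /\
    (forall phi psi : {rmorphism L -> R},
       mps_map phi F = G -> mps_map psi F = G -> phi =1 psi).

Definition strict_partition (la : seq nat) : bool :=
  sorted gtn la && (0%N \notin la).

Section HallLittlewood.
(* Lazard's theorem makes L a polynomial ring over the integers, hence a
   domain; the fractions below live in the fraction field of L[[x_1..x_n]]. *)
Variables (L : idomainType) (F : {mps L[2]}).

Local Notation "x %:F" := (tofrac x).

Definition cross_factor (n : nat) (r : nat) (x : 'I_n -> {mps L[n]}) :
    {fraction {mps L[n]}} :=
  \prod_(i < n | (i < r)%N) \prod_(j < n | (i < j)%N)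
    ((fgl_add F (x i) (x j))%:F / (fgl_add F (x i) (fgl_opp F (x j)))%:F).

Definition P_frac (n : nat) (la : seq nat) : {fraction {mps L[n]}} :=
  ((n - size la)`!)%:R^-1 * \sum_(w : 'S_n)
    let x := fun i : 'I_n => mpsX (w i) in
    (\prod_(i < n | (i < size la)%N) (x i ^+ nth 0%N la i)%:F)
      * cross_factor (size la) x.

Definition Q_frac (n : nat) (la : seq nat) : {fraction {mps L[n]}} :=
  ((n - size la)`!)%:R^-1 * \sum_(w : 'S_n)
    let x := fun i : 'I_n => mpsX (w i) in
    (\prod_(i < n | (i < size la)%N)
        (fgl_add F (x i) (x i) * x i ^+ (nth 0%N la i).-1)%:F)
      * cross_factor (size la) x.

(* The power series equal to the given fraction. *)
Definition series_of_frac (n : nat) (q : {fraction {mps L[n]}}) : {mps L[n]} :=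
  xget 0 [set p : {mps L[n]} | p%:F = q].

Definition P_fun (n : nat) (la : seq nat) : {mps L[n]} :=
  if (size la <= n)%N then series_of_frac (P_frac n la) else 0.

Definition Q_fun (n : nat) (la : seq nat) : {mps L[n]} :=
  if (size la <= n)%N then series_of_frac (Q_frac n la) else 0.

End HallLittlewood.

(* Main.v *)
(* After factoring out units, each quotient of formal sums becomes
     (x_i +_F x_j) / (x_i +_F \bar x_j) = C(x_i, x_j) / (x_j - x_i)
   for a power series C with C(b, 0) = - b.  Multiplying the symmetrized sum by
   the Vandermonde product gives an alternating series, which the Vandermonde
   product divides; grouping the permutations by cosets of the stabilizer of
   0, ..., r-1 extracts the factor (n-r)!.  Setting the last variable to 0 is
   defined on fractions whose denominator does not vanish there: a permutation
   sending some k < r to the last variable contributes 0, and in the others the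
   factors involving the last variable become C(x_i, 0) / (0 - x_i) = 1. *)
Require Import Defs.
From HB Require Import structures.
From mathcomp Require Import all_boot all_order all_algebra all_fingroup.
From mathcomp Require Import mpoly.
From mathcomp Require Import boolp classical_sets.

Set Implicit Arguments.
Unset Strict Implicit.
Unset Printing Implicit Defensive.

Import Order.TTheory GRing.Theory.
Local Open Scope ring_scope.

(** * Order of vanishing and fixed points *)

Section Order.
Variables (n : nat) (R : comNzRingType).
Implicit Types (f g h : {mps R[n]}) (m : 'X_{1..n}).

Lemma mpscoef0 m : mpscoef (0 : {mps R[n]}) m = 0.
Proof. by rewrite [LHS]/= if_same. Qed.

Lemma mpscoef1 m : mpscoef (1 : {mps R[n]}) m = (m == 0%MM)%:R.
Proof. by rewrite /=; case: eqP. Qed.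

Lemma mpscoefD f g m : mpscoef (f + g) m = mpscoef f m + mpscoef g m.
Proof. by []. Qed.

Lemma mpscoefN f m : mpscoef (- f) m = - mpscoef f m.
Proof. by []. Qed.

Lemma mpscoefB f g m : mpscoef (f - g) m = mpscoef f m - mpscoef g m.
Proof. by []. Qed.

Lemma mpscoef_sum (I : Type) (r : seq I) (P : pred I) (G : I -> {mps R[n]}) m :
  mpscoef (\sum_(i <- r | P i) G i) m = \sum_(i <- r | P i) mpscoef (G i) m.
Proof.
by elim/big_rec2: _ => [|i a b _ <-]; rewrite ?mpscoef0 ?mpscoefD.
Qed.

Lemma mpscoefMn f k m : mpscoef (f *+ k) m = mpscoef f m *+ k.
Proof.
by elim: k => [|k IH]; [rewrite !mulr0n mpscoef0|rewrite !mulrS mpscoefD IH].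
Qed.

Lemma mps_const_additive : {morph @mps_const n R : a b / a - b}.
Proof.
move=> a b; apply/mpsP => m; rewrite mpscoefB /=.
by case: ifP; rewrite ?subr0.
Qed.

Lemma mpscoef_constM c f m : mpscoef (mps_const n c * f) m = c * mpscoef f m.
Proof.
rewrite [LHS](@mps_mulE _ _ _ _ _ c%:MP (mps_trunc (mdeg m).+1 f)).
- by rewrite mcoeffCM mps_truncE.
- by move=> k _; rewrite mcoeffC /=; case: ifP; rewrite ?mulr1 ?mulr0.
- by move=> k km; rewrite mps_truncE.
Qed.

Lemma mps_const_multiplicative :
  mps_const n (1 : R) = 1 /\ {morph @mps_const n R : a b / a * b}.
Proof.
split=> // a b; apply/mpsP => m; rewrite mpscoef_constM /=.
by case: ifP; rewrite ?mulr0.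
Qed.

HB.instance Definition _ :=
  GRing.isZmodMorphism.Build R {mps R[n]} (@mps_const n R) mps_const_additive.
HB.instance Definition _ :=
  GRing.isMonoidMorphism.Build R {mps R[n]} (@mps_const n R)
    mps_const_multiplicative.

(** Membership in the d-th power of the ideal of the variables. [ordge 1] is the condition under
    which series are substituted below. *)
Definition ordge (d : nat) f := forall m, (mdeg m < d)%N -> mpscoef f m = 0.

Lemma ordge0 d : ordge d 0.
Proof. by move=> m _; rewrite mpscoef0. Qed.

Lemma ordge_0 f : ordge 0 f. Proof. by []. Qed.

Lemma ordge_1P f : ordge 1 f <-> mpscoef f 0%MM = 0.
Proof.
split=> [f1|f0 m]; first by rewrite f1 ?mdeg0.
by rewrite ltnS leqn0 mdeg_eq0 => /eqP ->.
Qed.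

Lemma ordgeW d e f : (d <= e)%N -> ordge e f -> ordge d f.
Proof. by move=> de fe m md; rewrite fe // (leq_trans md). Qed.

Lemma ordgeD d f g : ordge d f -> ordge d g -> ordge d (f + g).
Proof. by move=> fd gd m md; rewrite mpscoefD fd // gd // addr0. Qed.

Lemma ordgeN d f : ordge d f -> ordge d (- f).
Proof. by move=> fd m md; rewrite mpscoefN fd // oppr0. Qed.

Lemma ordgeB d f g : ordge d f -> ordge d g -> ordge d (f - g).
Proof. by move=> fd gd; apply: ordgeD => //; apply: ordgeN. Qed.

Lemma ordge_sum d (I : Type) (r : seq I) (P : pred I) (G : I -> {mps R[n]}) :
  (forall i, P i -> ordge d (G i)) -> ordge d (\sum_(i <- r | P i) G i).
Proof. by move=> Gd; elim/big_ind: _ => //; [exact: ordge0|exact: ordgeD]. Qed.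

Lemma ordgeM d e f g : ordge d f -> ordge e g -> ordge (d + e) (f * g).
Proof.
move=> fd ge m md; rewrite [LHS]big1 // => -[k l] /= /eqP mkl.
have [kd|kd] := ltnP (mdeg (k : 'X_{1..n})) d; first by rewrite fd // mul0r.
rewrite ge ?mulr0 // -(ltn_add2l (mdeg (k : 'X_{1..n}))) -mdegD -mkl.
by rewrite (leq_trans md) // leq_add2r.
Qed.

Lemma ordgeMr d f g : ordge d f -> ordge d (f * g).
Proof. by move=> fd; rewrite -[d]addn0; apply: ordgeM. Qed.

Lemma ordgeMl d f g : ordge d g -> ordge d (f * g).
Proof. by rewrite mulrC; apply: ordgeMr. Qed.

Lemma ordgeX d f k : ordge d f -> ordge (d * k) (f ^+ k).
Proof.
move=> fd; elim: k => [|k IH]; first by rewrite muln0.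
by rewrite exprS mulnS; apply: ordgeM.
Qed.

Lemma ordge_monomial p (g : 'I_p -> {mps R[n]}) (d : 'X_{1..p}) :
  (forall i, ordge 1 (g i)) -> ordge (mdeg d) (\prod_(i < p) g i ^+ d i).
Proof.
move=> g1; rewrite mdegE; elim/big_ind2: _ => // [|i _].
- by move=> a f b h fa hb; apply: ordgeM.
- by rewrite -[X in ordge X _]mul1n; apply: ordgeX.
Qed.

Definition eqmod d f g := ordge d (f - g).

Lemma eqmodxx d f : eqmod d f f.
Proof. by rewrite /eqmod subrr; apply: ordge0. Qed.

Lemma eqmod_sym d f g : eqmod d f g -> eqmod d g f.
Proof. by rewrite /eqmod -opprB => /ordgeN; rewrite opprK. Qed.

Lemma eqmod_trans d f g h : eqmod d f g -> eqmod d g h -> eqmod d f h.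
Proof. by move=> fg /(ordgeD fg); rewrite addrA subrK. Qed.

Lemma eqmod_coef d f g m : eqmod d f g -> (mdeg m < d)%N ->
  mpscoef f m = mpscoef g m.
Proof. by move=> fg /fg /eqP; rewrite mpscoefB subr_eq0 => /eqP. Qed.

Lemma eqmodM d f f' g g' :
  eqmod d f f' -> eqmod d g g' -> eqmod d (f * g) (f' * g').
Proof.
move=> ff gg; rewrite /eqmod.
have -> : f * g - f' * g' = (f - f') * g + f' * (g - g').
  by rewrite mulrBl mulrBr addrA subrK.
by apply: ordgeD; [apply: ordgeMr|apply: ordgeMl].
Qed.

Lemma eqmodX d f g k : eqmod d f g -> eqmod d (f ^+ k) (g ^+ k).
Proof.
move=> fg; elim: k => [|k IH]; first exact: eqmodxx.
by rewrite !exprS; apply: eqmodM.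
Qed.

Lemma eqmod_monomial d p (g h : 'I_p -> {mps R[n]}) (a : 'X_{1..p}) :
  (forall i, eqmod d (g i) (h i)) ->
  eqmod d (\prod_(i < p) g i ^+ a i) (\prod_(i < p) h i ^+ a i).
Proof.
move=> gh; elim/big_ind2: _ => [||i _]; first exact: eqmodxx.
- by move=> *; apply: eqmodM.
- exact: eqmodX.
Qed.

(* The fixed point is the limit of the iterates of Phi: the terms of degree d
   are stationary from the (d+1)-st iterate on. *)
Lemma contraction_fixpoint e (Phi : {mps R[n]} -> {mps R[n]}) :
  (forall f, ordge e f -> ordge e (Phi f)) ->
  (forall d f g, ordge e f -> ordge e g ->
     eqmod d f g -> eqmod d.+1 (Phi f) (Phi g)) ->
  exists2 f, ordge e f & Phi f = f.
Proof.
move=> ePhi ctr.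
pose it k := iter k Phi 0.
have eit k : ordge e (it k) by elim: k => [|k /ePhi//]; apply: ordge0.
have step k : eqmod k (it k) (it k.+1).
  by elim: k => [|k IH]; [apply: ordge_0|apply: ctr IH; apply: eit].
have stat d k : (d <= k)%N -> eqmod d (it d) (it k).
  elim: k => [|k IH]; first by rewrite leqn0 => /eqP ->; apply: eqmodxx.
  rewrite leq_eqVlt => /orP[/eqP ->|dk]; first exact: eqmodxx.
  by apply: eqmod_trans (IH _) _ => //; apply: ordgeW (step _).
pose f : {mps R[n]} := Mps (fun m => mpscoef (it (mdeg m).+1) m).
have fit d : eqmod d f (it d).
  by move=> m md; rewrite mpscoefB -(eqmod_coef (stat _ _ md)) ?subrr.
have ef : ordge e f by move=> m me; apply: eit.
exists f => //; apply/mpsP => m.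
have := eqmod_trans (ctr _ _ _ ef (eit _) (fit (mdeg m)))
  (eqmod_sym (fit (mdeg m).+1)).
by move/eqmod_coef; apply.
Qed.

(** The inverse is the fixed point of g |-> 1 + (1 - f) g, a contraction because 1 - f has no
    constant term. *)
Lemma mps_unit1 f : mpscoef f 0%MM = 1 -> f \is a GRing.unit.
Proof.
move=> f0; pose Phi g := 1 + (1 - f) * g.
have f1 : ordge 1 (1 - f).
  by apply/ordge_1P; rewrite mpscoefB mpscoef1 eqxx f0 subrr.
have [|d g h _ _ gh|g _ Eg] := @contraction_fixpoint 0 Phi.
- by [].
- rewrite /eqmod; have -> : Phi g - Phi h = (1 - f) * (g - h).
    by rewrite /Phi mulrBr opprD addrACA subrr add0r.
  by rewrite -add1n; apply: ordgeM.
apply/asboolP; exists g; apply/eqP; rewrite -subr_eq0 mulrC -oppr_eq0 opprB.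
have -> : 1 - f * g = Phi g - g.
  by rewrite /Phi mulrBl mul1r -addrA [g - _ - _]addrAC subrr add0r.
by rewrite Eg subrr.
Qed.

End Order.

(** * Substitution of power series *)

Section Substitution.
Variables (p n : nat) (R : comNzRingType).
Implicit Types (f : {mps R[p]}) (g h : 'I_p -> {mps R[n]}).

Local Notation const := (@mps_const n R : {rmorphism R -> {mps R[n]}}).

Lemma ordge_mmap d g (q : {mpoly R[p]}) :
  (forall i, ordge 1 (g i)) -> (forall k, (mdeg k < d)%N -> q@_k = 0) ->
  ordge d (mmap (@mps_const n R) g q).
Proof.
move=> g1 q0; rewrite /mmap big_seq; apply: ordge_sum => k.
rewrite mcoeff_msupp => qk; apply: ordgeMl.
apply: (@ordgeW _ _ d (mdeg k)); last exact: ordge_monomial.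
by rewrite leqNgt; apply: contra qk => /q0 ->.
Qed.

Lemma mmap_trunc d f g : mmap (@mps_const n R) g (mps_trunc d f) =
  \sum_(k : 'X_{1..p < d})
    mps_const n (mpscoef f k) * \prod_(i < p) g i ^+ (k : 'X_{1..p}) i.
Proof.
rewrite /mps_trunc (raddf_sum (mmap const g)) /=; apply: eq_bigr => k _.
by rewrite (mmapZ g const) (mmapX g const).
Qed.

(** The product of powers attached to an exponent d has order at least [mdeg d], so only the part of
    f of degree at most [mdeg k] matters. Trading f for a polynomial lets substitution inherit its
    algebra from [mmap]. *)
Lemma mps_substE f g (q : {mpoly R[p]}) k :
  (forall i, ordge 1 (g i)) ->
  (forall d, (mdeg d <= mdeg k)%N -> mpscoef f d = q@_d) ->
  mpscoef (mps_subst f g) k = mpscoef (mmap (@mps_const n R) g q) k.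
Proof.
move=> g1 fq; pose t := mps_trunc (mdeg k).+1 f.
have tE d : (mdeg d <= mdeg k)%N -> t@_d = mpscoef f d.
  by move=> dk; rewrite mps_truncE.
have -> : mpscoef (mps_subst f g) k = mpscoef (mmap (@mps_const n R) g t) k.
  rewrite mmap_trunc mpscoef_sum.
  by apply: eq_bigr => d _; rewrite mpscoef_constM.
have tq : eqmod (mdeg k).+1 (mmap const g t) (mmap const g q).
  rewrite /eqmod -mmapB; apply: ordge_mmap => // d dk.
  by rewrite mcoeffB tE // fq // subrr.
exact: eqmod_coef tq (ltnSn _).
Qed.

Section Morphism.
Variable (g : 'I_p -> {mps R[n]}).
Hypothesis g1 : forall i, ordge 1 (g i).

(** Binding [g1] in the body makes it an argument of [msubst], so that the ring morphism structure,
    which depends on it, can be attached to this constant. *)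
Definition msubst f := let _ := g1 in mps_subst f g.

Lemma msubst_additive : {morph msubst : a b / a - b}.
Proof.
move=> a b; apply/mpsP => k; pose t := @mps_trunc p R (mdeg k).+1.
rewrite mpscoefB (@mps_substE _ _ (t a - t b)) //; last first.
  by move=> d dk; rewrite mpscoefB mcoeffB !mps_truncE.
rewrite (mmapB g const) mpscoefB -(@mps_substE a _ (t a)) //
    -?(@mps_substE b _ (t b)) //;
  by move=> d dk; rewrite mps_truncE.
Qed.

Lemma msubst_multiplicative : msubst 1 = 1 /\ {morph msubst : a b / a * b}.
Proof.
split=> [|a b]; apply/mpsP => k.
  rewrite (@mps_substE _ _ 1) ?(rmorph1 (mmap const g)) //.
  by move=> d _; rewrite mpscoef1 mcoeff1.
pose t := @mps_trunc p R (mdeg k).+1.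
rewrite (@mps_substE _ _ (t a * t b)) //; last first.
  by move=> d dk; rewrite -mps_mulT.
have -> : mmap const g (t a * t b) = mmap const g (t a) * mmap const g (t b).
  exact: rmorphM.
have tE x : eqmod (mdeg k).+1 (mmap const g (t x)) (msubst x).
  move=> d dk; rewrite mpscoefB (@mps_substE _ _ (t x)) ?subrr // => e ed.
  by rewrite mps_truncE // (leq_ltn_trans ed).
exact: eqmod_coef (eqmodM (tE a) (tE b)) (ltnSn _).
Qed.

HB.instance Definition _ :=
  GRing.isZmodMorphism.Build {mps R[p]} {mps R[n]} msubst msubst_additive.
HB.instance Definition _ :=
  GRing.isMonoidMorphism.Build {mps R[p]} {mps R[n]} msubst
    msubst_multiplicative.

Lemma mps_subst0 : mps_subst 0 g = 0.
Proof. exact: rmorph0 msubst. Qed.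

Lemma mps_subst1 : mps_subst 1 g = 1.
Proof. exact: rmorph1 msubst. Qed.

Lemma mps_substD a b : mps_subst (a + b) g = mps_subst a g + mps_subst b g.
Proof. exact: (rmorphD msubst). Qed.

Lemma mps_substN a : mps_subst (- a) g = - mps_subst a g.
Proof. exact: (rmorphN msubst). Qed.

Lemma mps_substB a b : mps_subst (a - b) g = mps_subst a g - mps_subst b g.
Proof. exact: (rmorphB msubst). Qed.

Lemma mps_substM a b : mps_subst (a * b) g = mps_subst a g * mps_subst b g.
Proof. exact: (rmorphM msubst). Qed.

Lemma mps_substXn a k : mps_subst (a ^+ k) g = mps_subst a g ^+ k.
Proof. exact: (rmorphXn msubst). Qed.

Lemma mps_subst_const c : mps_subst (mps_const p c) g = mps_const n c.
Proof.
apply/mpsP => k; rewrite (@mps_substE _ _ c%:MP) ?(mmapC g const) //.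
by move=> d _; rewrite mcoeffC /=; case: ifP; rewrite ?mulr1 ?mulr0.
Qed.

Lemma mps_substX i : mps_subst (mpsX i) g = g i.
Proof.
apply/mpsP => k; rewrite (@mps_substE _ _ 'X_i) //.
  by rewrite (mmapX g const) mmap1U.
by move=> d _; rewrite mcoeffX eq_sym.
Qed.

Lemma ordge_subst d f : ordge d f -> ordge d (mps_subst f g).
Proof.
move=> fd m md; rewrite (@mps_substE _ _ 0) ?(rmorph0 (mmap const g)) //.
  by rewrite mpscoef0.
by move=> k km; rewrite mcoeff0 fd // (leq_ltn_trans km).
Qed.

Lemma eqmod_subst d f f' :
  eqmod d f f' -> eqmod d (mps_subst f g) (mps_subst f' g).
Proof. by rewrite /eqmod -mps_substB; apply: ordge_subst. Qed.

Lemma mpscoef_subst0 f : mpscoef (mps_subst f g) 0%MM = mpscoef f 0%MM.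
Proof.
have E : ordge 1 (f - mps_const p (mpscoef f 0%MM)).
  by apply/ordge_1P; rewrite mpscoefB /= eqxx subrr.
have := eqmod_coef (eqmod_subst E) (m := 0%MM).
by rewrite mdeg0 mps_subst_const => -> //=; rewrite eqxx.
Qed.

End Morphism.

Lemma eqmod_substr d f g h : (forall i, eqmod d (g i) (h i)) ->
  eqmod d (mps_subst f g) (mps_subst f h).
Proof.
move=> gh m md; rewrite mpscoefB /= -sumrB big1 // => k _.
by rewrite -mulrBr (eqmod_coef (eqmod_monomial _ gh) md) subrr mulr0.
Qed.

Lemma eq_mps_subst f g h : g =1 h -> mps_subst f g = mps_subst f h.
Proof. by move=> gh; congr mps_subst; apply/funext. Qed.

End Substitution.

Section Composition.
Variables (p n q : nat) (R : comNzRingType).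

(** For the coefficient at k, f may be replaced by a truncation; the outer substitution, being a
    ring morphism, then passes through the finite sum. *)
Lemma mps_subst_comp (f : {mps R[p]}) (g : 'I_p -> {mps R[n]})
    (h : 'I_n -> {mps R[q]}) :
  (forall i, ordge 1 (g i)) -> (forall i, ordge 1 (h i)) ->
  mps_subst (mps_subst f g) h = mps_subst f (fun i => mps_subst (g i) h).
Proof.
move=> g1 h1; apply/mpsP => k; pose t := mps_trunc (mdeg k).+1 f.
have gh1 i : ordge 1 (mps_subst (g i) h) by apply: ordge_subst.
rewrite [RHS](@mps_substE _ _ _ _ _ t) //; last first.
  by move=> d dk; rewrite mps_truncE.
have ft : eqmod (mdeg k).+1 (mps_subst f g) (mmap (@mps_const n R) g t).
  move=> d dk; rewrite mpscoefB (@mps_substE _ _ _ _ _ t) ?subrr // => e ed.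
  by rewrite mps_truncE // (leq_ltn_trans ed).
rewrite (eqmod_coef (eqmod_subst h1 ft) (ltnSn _)); congr mpscoef.
rewrite -[LHS]/(msubst h1 _) /mmap rmorph_sum; apply: eq_bigr => d _.
rewrite rmorphM; congr (_ * _); first exact: mps_subst_const.
by rewrite rmorph_prod; apply: eq_bigr => i _; rewrite rmorphXn.
Qed.

End Composition.

Section Monomials.
Variables (n : nat) (R : comNzRingType).

Lemma mpsX_monomial (d : 'X_{1..n}) :
  \prod_(i < n) mpsX i ^+ d i = Mps (fun m => (m == d)%:R) :> {mps R[n]}.
Proof.
(* Polynomials embed multiplicatively in series, which carries over the factorization of
   ['X_[d]]. *)
pose iota (q : {mpoly R[n]}) : {mps R[n]} := Mps (fun m => q@_m).
have iM : {morph iota : a b / a * b}.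
  by move=> a b; apply/mpsP => m; rewrite [RHS](@mps_mulE _ _ _ _ _ a b).
have i1 : iota 1 = 1 by apply/mpsP => m; rewrite mpscoef1 /= mcoeff1.
have -> : Mps (fun m => (m == d)%:R) = iota 'X_[d].
  by apply/mpsP => m /=; rewrite mcoeffX eq_sym.
rewrite mpolyXE_id (big_morph _ iM i1); apply: eq_bigr => i _.
have -> : mpsX i = iota 'X_i by apply/mpsP => m /=; rewrite mcoeffX eq_sym.
by elim: (d i) => // k IH; rewrite !exprS IH iM.
Qed.

Lemma mps_subst_id (f : {mps R[n]}) : mps_subst f mpsX = f.
Proof.
apply/mpsP => k /=; have kk : (mdeg k < (mdeg k).+1)%N by [].
rewrite (bigD1 (BMultinom kk)) //= mpsX_monomial /= eqxx mulr1 big1 ?addr0 //.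
move=> d; rewrite -val_eqE /= mpsX_monomial /= eq_sym => /negPf ->.
by rewrite mulr0.
Qed.

End Monomials.

(** * Divisibility and formal group laws *)

Section Divisibility.
Variables (n : nat) (R : comNzRingType).
Implicit Types (f : {mps R[n]}) (i j : 'I_n).

Lemma mpsX_ordge i : ordge 1 (mpsX i : {mps R[n]}).
Proof. by apply/ordge_1P => /=; rewrite eq_sym mnm1_eq0. Qed.

Definition replaceX i (a : {mps R[n]}) : 'I_n -> {mps R[n]} :=
  fun k => if k == i then a else mpsX k.

Lemma replaceX_ordge i a : ordge 1 a -> forall k, ordge 1 (replaceX i a k).
Proof.
by move=> a1 k; rewrite /replaceX; case: ifP => _ //; apply: mpsX_ordge.
Qed.

Lemma mpscoef_setX0 f i (m : 'X_{1..n}) : m i = 0%N ->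
  mpscoef (mps_subst f (replaceX i 0)) m = mpscoef f m.
Proof.
move=> mi; rewrite -[f in RHS]mps_subst_id /=; apply: eq_bigr => d _.
have [di|di] := posnP ((d : 'X_{1..n}) i).
  congr (_ * mpscoef _ _); apply: eq_bigr => k _; rewrite /replaceX.
  by case: eqP => // ->; rewrite di !expr0.
congr (_ * _); rewrite mpsX_monomial.
have -> : \prod_(k < n) replaceX i 0 k ^+ (d : 'X_{1..n}) k = 0.
  by rewrite (bigD1 i) //= {1}/replaceX eqxx -(prednK di) exprS !mul0r.
rewrite mpscoef0 /=; case: eqP => // md.
by move: di; rewrite -md mi.
Qed.

(** The quotient is obtained by shifting exponents by [U_(i)]; nothing is lost, since by hypothesis
    f has no monomial free of x_i. *)
Lemma mps_dvdX f i : mps_subst f (replaceX i 0) = 0 -> exists q, f = mpsX i * q.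
Proof.
move=> f0; exists (Mps (fun m => mpscoef f (U_(i) + m)%MM)).
apply/mpsP => m; have [mi|mi] := posnP (m i).
  rewrite -(mpscoef_setX0 _ mi) f0 mpscoef0 [RHS]/= big1 // => -[k l] /= /eqP E.
  case: eqP => [ki|_]; last by rewrite mul0r.
  have := congr1 (fun a : 'X_{1..n} => a i) E.
  by rewrite mi ki mnmDE mnm1E eqxx.
have Um : (U_(i) <= m)%MM by rewrite lep1mP -lt0n.
rewrite -(submK Um) addmC; set k := (m - _)%MM.
pose g : {mps R[n]} := Mps (fun m => mpscoef f (U_(i) + m)%MM).
rewrite (@mps_mulE _ _ _ _ _ 'X_i (mps_trunc (mdeg (U_(i) + k)%MM).+1 g)).
- rewrite mulrC mcoeffMX mps_truncE // ltnS mdegD leq_addl //.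
- by move=> j _ /=; rewrite mcoeffX eq_sym.
- by move=> j jk; rewrite mps_truncE.
Qed.

(* The automorphism x_i |-> x_i + x_j turns divisibility by x_i - x_j into
   divisibility by x_i. *)
Lemma mps_dvdXB f i j : i != j -> mps_subst f (replaceX i (mpsX j)) = 0 ->
  exists q, f = (mpsX i - mpsX j) * q.
Proof.
move=> ij fij; pose Xi : {mps R[n]} := mpsX i; pose Xj : {mps R[n]} := mpsX j.
have X1 k : ordge 1 (mpsX k : {mps R[n]}) by apply: mpsX_ordge.
have a1 := replaceX_ordge i (ordgeD (X1 i) (X1 j)).
have s1 := replaceX_ordge i (ordgeB (X1 i) (X1 j)).
have z1 := replaceX_ordge i (@ordge0 n R 1).
have [q Eq] : exists q, mps_subst f (replaceX i (Xi + Xj)) = Xi * q.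
  apply: mps_dvdX; rewrite mps_subst_comp // -[RHS]fij.
  apply: eq_mps_subst => k; rewrite /replaceX; case: ifP => // ki.
    rewrite mps_substD // !mps_substX // /replaceX eqxx eq_sym (negPf ij).
    by rewrite add0r.
  by rewrite mps_substX // /replaceX ki.
(* The inverse automorphism x_i |-> x_i - x_j carries the factorization x_i q back to f. *)
exists (mps_subst q (replaceX i (Xi - Xj))).
transitivity (mps_subst (Xi * q) (replaceX i (Xi - Xj))); last first.
  by rewrite mps_substM // mps_substX // {1}/replaceX eqxx.
rewrite -Eq mps_subst_comp // -[LHS]mps_subst_id.
apply: eq_mps_subst => k; rewrite /replaceX; case: ifP => [/eqP ->|ki].
  rewrite mps_substD // !mps_substX // /replaceX eqxx eq_sym (negPf ij).
  by rewrite subrK.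
by rewrite mps_substX // /replaceX ki.
Qed.

Lemma mpsX_inj : injective (mpsX : 'I_n -> {mps R[n]}).
Proof.
move=> i j /(congr1 (fun f => mpscoef f U_(i)%MM)) /=; rewrite eqxx.
case: eqP => [/mnmP/(_ i)|_ /eqP]; last by rewrite oner_eq0.
by rewrite !mnm1E eqxx; case: eqP.
Qed.

Lemma mpsX_neq0 i : mpsX i != 0 :> {mps R[n]}.
Proof.
apply/eqP => /(congr1 (fun f => mpscoef f U_(i)%MM)).
by rewrite mpscoef0 /= eqxx => /eqP; rewrite oner_eq0.
Qed.

End Divisibility.

Section FormalGroup.

Lemma ord2_neq0 (i : 'I_2) : i != ord0 -> i = ord_max.
Proof. by case: i => -[|[]] // p _; apply/val_inj. Qed.

Section Subst2.
Variables (R : comNzRingType) (n : nat) (a b : {mps R[n]}).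
Hypotheses (a1 : ordge 1 a) (b1 : ordge 1 b).

Lemma pair_ordge (i : 'I_2) : ordge 1 (if i == ord0 then a else b).
Proof. by case: ifP. Qed.

Definition fgl_addE := (mps_substD pair_ordge, mps_substB pair_ordge,
  mps_substN pair_ordge, mps_substM pair_ordge, mps_subst1 pair_ordge,
  mps_substX pair_ordge).

Lemma fgl_add_subst q G (h : 'I_n -> {mps R[q]}) : (forall i, ordge 1 (h i)) ->
  mps_subst (fgl_add G a b) h = fgl_add G (mps_subst a h) (mps_subst b h).
Proof.
move=> h1; rewrite mps_subst_comp //; last exact: pair_ordge.
by apply: eq_mps_subst => i; case: ifP.
Qed.

End Subst2.

Variables (L : idomainType) (F : {mps L[2]}).
Hypothesis F0r : fgl_add F (mpsX ord0) 0 = mpsX ord0 :> {mps L[1]}.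
Hypothesis F0l : fgl_add F 0 (mpsX ord0) = mpsX ord0 :> {mps L[1]}.

Let z1 n : ordge 1 (0 : {mps L[n]}). Proof. exact: ordge0. Qed.
Let X1 n i : ordge 1 (mpsX i : {mps L[n]}). Proof. exact: mpsX_ordge. Qed.

Lemma fgl_addr0 n (a : {mps L[n]}) : ordge 1 a -> fgl_add F a 0 = a.
Proof.
move=> a1; have := congr1 (fun f => mps_subst f (fun=> a)) F0r.
by rewrite fgl_add_subst // mps_substX // mps_subst0.
Qed.

Lemma fgl_add0r n (a : {mps L[n]}) : ordge 1 a -> fgl_add F 0 a = a.
Proof.
move=> a1; have := congr1 (fun f => mps_subst f (fun=> a)) F0l.
by rewrite fgl_add_subst // mps_substX // mps_subst0.
Qed.

Lemma replaceX0_fgl G (a : {mps L[2]}) :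
  mps_subst G (replaceX ord0 a) = fgl_add G a (mpsX ord_max).
Proof.
apply: eq_mps_subst => i; rewrite /replaceX; case: ifPn => // /ord2_neq0 -> //.
Qed.

Lemma replaceX1_fgl G (a : {mps L[2]}) :
  mps_subst G (replaceX ord_max a) = fgl_add G (mpsX ord0) a.
Proof.
apply: eq_mps_subst => i; rewrite /replaceX; case: (i =P ord0) => [->|/eqP] //.
by move/ord2_neq0 ->.
Qed.

(** F - u - v vanishes at u = 0 and at v = 0, so u and then v can be divided out. *)
Lemma fgl_add_expansion : exists H : {mps L[2]},
  forall n (a b : {mps L[n]}), ordge 1 a -> ordge 1 b ->
    fgl_add F a b = a + b + a * b * fgl_add H a b.
Proof.
pose u : {mps L[2]} := mpsX ord0; pose v : {mps L[2]} := mpsX ord_max.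
have [q Eq] : exists q, F - u - v = u * q.
  apply: mps_dvdX; rewrite replaceX0_fgl.
  transitivity (fgl_add F 0 v - (0 : {mps L[2]}) - v).
    by rewrite /fgl_add !fgl_addE.
  by rewrite (fgl_add0r (X1 _)) subr0 subrr.
have [H EH] : exists H, q = v * H.
  (* q(u, 0) is shown to vanish after multiplication by u, since u q(u, 0) = F(u, 0) - u. *)
  apply: mps_dvdX; apply: (mulfI (mpsX_neq0 _ ord0));
  rewrite mulr0 replaceX1_fgl.
  have E : fgl_add F u 0 - u - 0 = u * fgl_add q u 0.
    transitivity (fgl_add (F - u - v) u 0).
      by rewrite /fgl_add !(fgl_addE (X1 ord0) (@z1 2)).
    by rewrite Eq /fgl_add !(fgl_addE (X1 ord0) (@z1 2)).
  by rewrite -E (fgl_addr0 (X1 _)) subrr subr0.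
exists H => n a b a1 b1.
have -> : F = u + v + u * v * H.
  rewrite -mulrA -EH -Eq -[F - u - v]addrA -opprD.
  by rewrite [RHS]addrC subrK.
by rewrite /fgl_add !fgl_addE.
Qed.

(** With F = u + v + u v H, the inverse is the solution of c = - x - x c H(x, c). The factor x
    raises the order by one, which makes the right-hand side a contraction in c. *)
Lemma fgl_inv_exists : exists chi : {mps L[1]},
  mpscoef chi 0%MM = 0 /\ fgl_add F (mpsX ord0) chi = 0.
Proof.
have [H FH] := fgl_add_expansion.
pose x : {mps L[1]} := mpsX ord0.
have x1 : ordge 1 x by apply: X1.
pose Phi c := - x - x * (c * fgl_add H x c).
have [||c c1 Ec] := @contraction_fixpoint 1 L 1 Phi.
- by move=> c c1; apply: ordgeB; [apply: ordgeN|apply: ordgeMr].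
- move=> d f g f1 g1 fg; rewrite /eqmod.
  have -> : Phi f - Phi g = x * (g * fgl_add H x g - f * fgl_add H x f).
    by rewrite /Phi opprD addrACA subrr add0r opprK addrC -mulrBr.
  rewrite -[d.+1]add1n; apply: ordgeM => //; apply: eqmodM.
    exact: eqmod_sym.
  apply: eqmod_substr => i; case: ifP => _; first exact: eqmodxx.
  exact: eqmod_sym.
exists c; split; first exact/ordge_1P.
rewrite FH // -mulrA -[X in x + X + _]Ec /Phi.
by rewrite [x + _]addrA subrr sub0r addNr.
Qed.

Lemma fgl_inv_ordge : ordge 1 (fgl_inv_series F).
Proof.
apply/ordge_1P; rewrite /fgl_inv_series.
by case: xgetP => [c _ [] //|_]; rewrite mpscoef0.
Qed.

Lemma fgl_addrX : fgl_add F (mpsX ord0) (fgl_inv_series F) = 0.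
Proof.
rewrite /fgl_inv_series; case: xgetP => [c _ [] //|none].
by have [c Ec] := fgl_inv_exists; case: (none c).
Qed.

Lemma fgl_opp_ordge n (a : {mps L[n]}) : ordge 1 a -> ordge 1 (fgl_opp F a).
Proof. by move=> a1; apply: ordge_subst => //; apply: fgl_inv_ordge. Qed.

Lemma fgl_opp_subst n p (a : {mps L[n]}) (h : 'I_n -> {mps L[p]}) :
  ordge 1 a -> (forall i, ordge 1 (h i)) ->
  mps_subst (fgl_opp F a) h = fgl_opp F (mps_subst a h).
Proof. by move=> a1 h1; rewrite [LHS]mps_subst_comp. Qed.

Lemma fgl_addrN n (a : {mps L[n]}) : ordge 1 a -> fgl_add F a (fgl_opp F a) = 0.
Proof.
move=> a1; have := congr1 (fun f => mps_subst f (fun=> a)) fgl_addrX.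
by rewrite fgl_add_subst ?mps_substX ?mps_subst0 //; apply: fgl_inv_ordge.
Qed.

Lemma fgl_opp0 n : fgl_opp F 0 = 0 :> {mps L[n]}.
Proof.
by rewrite -[RHS](@fgl_addrN n 0) // fgl_add0r //; apply: fgl_opp_ordge.
Qed.

(** The formal difference vanishes on a = b, hence is divisible by a - b. Comparing both sides at b
    = 0 gives U(u, 0) = 1, so U has constant term 1 and is invertible. *)
Lemma fgl_sub_factor : exists2 U : {mps L[2]}, U \is a GRing.unit &
  forall n (a b : {mps L[n]}), ordge 1 a -> ordge 1 b ->
    fgl_add F a (fgl_opp F b) = (a - b) * fgl_add U a b.
Proof.
pose u : {mps L[2]} := mpsX ord0; pose v : {mps L[2]} := mpsX ord_max.
pose K := fgl_add F u (fgl_opp F v).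
have KE n (a b : {mps L[n]}) : ordge 1 a -> ordge 1 b ->
    fgl_add K a b = fgl_add F a (fgl_opp F b).
  move=> a1 b1; have ab1 := pair_ordge a1 b1.
  rewrite [LHS](fgl_add_subst (X1 _) (fgl_opp_ordge (X1 _))) //.
  by rewrite fgl_opp_subst // !mps_substX.
have [U EU] : exists U, K = (u - v) * U.
  by apply: mps_dvdXB => //; rewrite replaceX0_fgl KE // fgl_addrN.
have UE n (a b : {mps L[n]}) : ordge 1 a -> ordge 1 b ->
    fgl_add F a (fgl_opp F b) = (a - b) * fgl_add U a b.
  by move=> a1 b1; rewrite -KE // EU /fgl_add !fgl_addE.
exists U => //; apply: mps_unit1.
have Uu : fgl_add U u 0 = 1.
  apply: (mulfI (mpsX_neq0 L (ord0 : 'I_2))).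
  have := UE _ u 0 (X1 _) (@z1 _).
  by rewrite fgl_opp0 (fgl_addr0 (X1 _)) subr0 mulr1 => <-.
rewrite -(mpscoef_subst0 (pair_ordge (X1 ord0) (@z1 2))).
by rewrite [mps_subst _ _]Uu mpscoef1 eqxx.
Qed.

(** C = - F / U with U from [fgl_sub_factor]; the sign turns a - b into b - a, the orientation of
    the Vandermonde factors. The value at b = 0 comes from F(a, 0) = a and U(a, 0) = 1. *)
Lemma fgl_quotient : exists C : {mps L[2]},
  (forall n (a b : {mps L[n]}), ordge 1 a -> ordge 1 b -> a != b ->
    tofrac (fgl_add F a b) / tofrac (fgl_add F a (fgl_opp F b)) =
    tofrac (fgl_add C a b) / tofrac (b - a)) /\
  (forall n (a : {mps L[n]}), ordge 1 a -> fgl_add C a 0 = - a).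
Proof.
have [U Uu UE] := fgl_sub_factor.
have UV n (a b : {mps L[n]}) : ordge 1 a -> ordge 1 b ->
    fgl_add U a b * fgl_add U^-1 a b = 1.
  move=> a1 b1; rewrite -[LHS](mps_substM (pair_ordge a1 b1)).
  by rewrite mulrV // fgl_addE.
have CE n (a b : {mps L[n]}) : ordge 1 a -> ordge 1 b ->
    fgl_add (- F * U^-1) a b = - fgl_add F a b * fgl_add U^-1 a b.
  by move=> a1 b1; rewrite /fgl_add !fgl_addE.
exists (- F * U^-1); split=> [n a b a1 b1 ab|n a a1].
  have ab0 : a - b != 0 by rewrite subr_eq0.
  have U0 : fgl_add U a b != 0.
    apply/eqP => E; have /eqP := UV n a b a1 b1.
    by rewrite E mul0r eq_sym oner_eq0.
  apply/eqP; rewrite eqr_div ?tofrac_eq0 ?UE ?mulf_neq0 //; last first.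
    by rewrite subr_eq0 eq_sym.
  rewrite -!tofracM tofrac_eq CE // [(a - b) * _]mulrC mulrA.
  rewrite -[_ * fgl_add U a b]mulrA [fgl_add U^-1 a b * _]mulrC UV // mulr1.
  by rewrite mulNr -mulrN opprB.
rewrite CE // fgl_addr0 //.
(* U(a, 0) = 1 is obtained by cancelling a, so a = 0 is treated apart. *)
have [->|a0] := eqVneq a 0; first by rewrite oppr0 mul0r.
have Ua : fgl_add U a 0 = 1.
  apply: (mulfI a0); have := UE n a 0 a1 (@z1 _).
  by rewrite fgl_opp0 fgl_addr0 // subr0 mulr1 => <-.
by have := UV n a 0 a1 (@z1 _); rewrite Ua mul1r => ->; rewrite mulr1.
Qed.

End FormalGroup.

(** * Sums over permutations, fractions and specialization *)

(** T is constant on each right coset of H, which contributes [#|H|] copies of the value at a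
    representative. *)
Lemma sum_coset_invariant (gT : finGroupType) (V : nmodType) (H : {group gT})
    (T : gT -> V) : (forall s w, s \in H -> T (s * w)%g = T w) ->
  exists h, \sum_(w : gT) T w = h *+ #|H|.
Proof.
move=> TH; exists (\sum_(D in rcosets H (setTfor gT)) T (repr D)).
rewrite (partition_big (fun w => (H :* w)%g)
  (fun D => D \in rcosets H (setTfor gT))) /=; last first.
  move=> w _.
  by rewrite mem_rcosets (mulSGid (finset.subsetT H)) finset.in_setT.
rewrite -sumrMnl; apply: eq_bigr => _ /rcosetsP[w _ ->].
rewrite -(card_rcoset H w) -sumr_const; apply: eq_big => [v|v /eqP Ev].
  by rewrite (sameP eqP rcoset_eqP).
have /rcosetP[s sH ->] : repr (H :* w)%g \in (H :* v)%g.
  by rewrite Ev mem_repr_rcoset.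
by rewrite TH.
Qed.

(** Permutations are grouped by the index k that they send to j; [lift_perm k j] identifies each
    group with ['S_n]. *)
Lemma sum_lift_perm (V : nmodType) n (j : 'I_n.+1) (G : 'S_n.+1 -> V) :
  \sum_(w : 'S_n.+1) G w = \sum_(k < n.+1) \sum_(s : 'S_n) G (lift_perm k j s).
Proof.
rewrite (partition_big (fun w : 'S_n.+1 => (w^-1)%g j) xpredT) //=.
apply: eq_bigr => k _; rewrite (reindex (lift_perm k j)) /=.
  by apply: eq_bigl => s; apply/eqP/(canLR (permK _)); rewrite lift_perm_id.
(* [del w] deletes k from the source and [w k] from the target. The default of [odflt] is never
   reached, as [w (lift k i)] differs from [w k]. *)
pose del (w : 'S_n.+1) i := odflt i (unlift (w k) (w (lift k i))).
have delK (w : 'S_n.+1) i : lift (w k) (del w i) = w (lift k i).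
  rewrite /del; have := neq_lift k i.
  by rewrite -(inj_eq (@perm_inj _ w)) => /unlift_some[? ? ->].
have del_inj (w : 'S_n.+1) : injective (del w).
  move=> i i' Eii; apply: (@lift_inj _ k); apply: (@perm_inj _ w).
  by rewrite -!delK Eii.
exists (fun w => perm (del_inj w)) => [s _|w].
  by apply/permP=> i; rewrite permE /del lift_perm_lift lift_perm_id liftK.
move/eqP => wk; have wkj : w k = j by rewrite -wk permKV.
apply/permP=> i; case: (unliftP k i) => [i'|] ->; last by rewrite lift_perm_id.
by rewrite lift_perm_lift -wkj permE delK.
Qed.

Section Specialization.
Variables (A B : idomainType) (phi : {rmorphism A -> B}).
Local Notation "x %:F" := (tofrac x).

(* The localization of A at the kernel of phi maps to the fractions of B;
   this is the graph of that map. *)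
Definition specializes (q : {fraction A}) (q' : {fraction B}) :=
  exists nd : A * A, [/\ phi nd.2 != 0, q = nd.1%:F / nd.2%:F
    & q' = (phi nd.1)%:F / (phi nd.2)%:F].

Lemma specializes_neq0 a : phi a != 0 -> a != 0.
Proof. by apply: contra => /eqP ->; rewrite rmorph0. Qed.

Lemma specializes_frac a d : phi d != 0 ->
  specializes (a%:F / d%:F) ((phi a)%:F / (phi d)%:F).
Proof. by move=> d0; exists (a, d). Qed.

Lemma specializes_tofrac a : specializes a%:F (phi a)%:F.
Proof.
have := @specializes_frac a 1.
by rewrite rmorph1 !tofrac1 !divr1; apply; apply: oner_neq0.
Qed.

Lemma specializesM q q' t t' :
  specializes q q' -> specializes t t' -> specializes (q * t) (q' * t').
Proof.
move=> [[a b] /= [b0 -> ->]] [[c d] /= [d0 -> ->]].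
have bd0 : phi (b * d) != 0 by rewrite rmorphM mulf_neq0.
have := specializes_frac (a * c) bd0.
by rewrite !rmorphM /= !mulf_div.
Qed.

Lemma specializesD q q' t t' :
  specializes q q' -> specializes t t' -> specializes (q + t) (q' + t').
Proof.
move=> [[a b] /= [b0 -> ->]] [[c d] /= [d0 -> ->]].
have bd0 : phi (b * d) != 0 by rewrite rmorphM mulf_neq0.
have := specializes_frac (a * d + c * b) bd0.
by rewrite !(rmorphD, rmorphM) /= !addf_div ?tofrac_eq0 ?specializes_neq0.
Qed.

Lemma specializes_sum (I : Type) (r : seq I) (P : pred I) G G' :
  (forall i, P i -> specializes (G i) (G' i)) ->
  specializes (\sum_(i <- r | P i) G i) (\sum_(i <- r | P i) G' i).
Proof.
move=> GG; elim/big_ind2: _ => //; last by move=> *; apply: specializesD.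
by have := specializes_tofrac 0; rewrite !rmorph0.
Qed.

Lemma specializes_prod (I : Type) (r : seq I) (P : pred I) G G' :
  (forall i, P i -> specializes (G i) (G' i)) ->
  specializes (\prod_(i <- r | P i) G i) (\prod_(i <- r | P i) G' i).
Proof.
move=> GG; elim/big_ind2: _ => //; last by move=> *; apply: specializesM.
by have := specializes_tofrac 1; rewrite !rmorph1.
Qed.

(** Clearing denominators gives a d = c in A, and phi can be applied to this equation; so the
    relation is single-valued on elements of A. *)
Lemma specializes_inj a q : specializes a%:F q -> q = (phi a)%:F.
Proof.
case=> -[c d] /= [d0 Ea ->].
have d1 : d%:F != 0 by rewrite tofrac_eq0 specializes_neq0.
have {Ea} /eqP : (a * d)%:F = c%:F by rewrite tofracM Ea divfK.
rewrite tofrac_eq => /eqP <-.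
by rewrite rmorphM tofracM mulfK // tofrac_eq0.
Qed.

End Specialization.

Section Vandermonde.
Variables (R : comNzRingType) (n : nat).

Definition vdm (x : 'I_n -> R) :=
  \prod_(i < n) \prod_(j < n | (i < j)%N) (x j - x i).

(** The product is a Vandermonde determinant, and w permutes its columns. *)
Lemma vdm_perm x (w : 'S_n) : vdm (x \o w) = (-1) ^+ w * vdm x.
Proof.
have vE y : vdm y = \det (Vandermonde n (\row_i y i)).
  rewrite det_Vandermonde; apply: eq_bigr => i _; apply: eq_bigr => j _.
  by rewrite !mxE.
rewrite !vE -[in RHS](odd_permV w) -det_perm mulrC -det_mulmx -col_permE.
by congr (\det _); apply/matrixP => i j; rewrite !mxE.
Qed.

End Vandermonde.

(** * Hall-Littlewood sums *)

Lemma card_ord_geq n r : (r <= n)%N ->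
  #|[pred i : 'I_n | ~~ (i < r)%N]| = (n - r)%N.
Proof.
move=> rn; have := cardC [pred i : 'I_n | (i < r)%N].
rewrite card_ord -{1}sum1_card (big_ord_narrow rn) sum1_card card_ord => E.
by apply: (@addnI r); rewrite subnKC // -[RHS]E.
Qed.

Lemma big_lift_notin (R : comNzRingType) n (k : 'I_n.+1) (P : pred 'I_n.+1)
    (G : 'I_n.+1 -> R) : ~~ P k ->
  \prod_(i | P i) G i = \prod_(i < n | P (lift k i)) G (lift k i).
Proof.
move=> Pk; rewrite big_mkcond (bigD1_ord k) //= (negPf Pk) mul1r.
by rewrite -big_mkcond.
Qed.

Lemma mps_subst_at0 (R : comNzRingType) n (f : {mps R[1]}) : ordge 1 f ->
  mps_subst f (fun=> 0) = 0 :> {mps R[n]}.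
Proof.
move=> /ordge_1P f0; apply/mpsP => m; rewrite mpscoef0 /= big1 // => d _.
rewrite big_ord1; have [d0|d0] := posnP ((d : 'X_{1..1}) ord0).
  suff -> : bmnm d = 0%MM by rewrite f0 mul0r.
  by apply/mnmP => i; rewrite ord1 d0 mnm0E.
by rewrite -(prednK d0) exprS mul0r mpscoef0 mulr0.
Qed.

Section HallLittlewoodSum.
Variables (L : idomainType) (C : {mps L[2]}) (a : nat -> {mps L[1]}).
Hypothesis L_char0 : forall k, (k.+1)%:R != 0 :> L.
Local Notation "x %:F" := (tofrac x).

Lemma mps_char0 m (f : {mps L[m]}) k : f *+ k.+1 = 0 -> f = 0.
Proof.
move=> fk; apply/mpsP => d; rewrite mpscoef0.
have := congr1 (fun g => mpscoef g d) fk.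
rewrite mpscoefMn mpscoef0 -mulr_natr => /eqP.
by rewrite mulf_eq0 (negPf (L_char0 k)) orbF => /eqP.
Qed.

Lemma tofrac_fact_neq0 m k : (k`!)%:R != 0 :> {fraction {mps L[m]}}.
Proof.
rewrite -(rmorph_nat (@tofrac {mps L[m]})) tofrac_eq0.
rewrite -(prednK (fact_gt0 k)); apply/eqP => /mps_char0/eqP.
by rewrite oner_eq0.
Qed.

(** Treats P and Q at once: [a i] is the one-variable series attached to the i-th part, later
    [P_series] or [Q_series]. *)
Definition hl_term m n r (x : 'I_n -> {mps L[m]}) : {fraction {mps L[m]}} :=
  (\prod_(i < n | (i < r)%N) (mps_subst (a i) (fun=> x i))%:F) *
  \prod_(i < n | (i < r)%N) \prod_(j < n | (i < j)%N)
    ((fgl_add C (x i) (x j))%:F / (x j - x i)%:F).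

Definition hl_frac n r : {fraction {mps L[n]}} :=
  ((n - r)`!)%:R^-1 * \sum_(w : 'S_n) hl_term r (fun i => mpsX (w i)).

(** The numerator of [hl_term] over the full Vandermonde product; the last factor supplies the
    differences with i >= r, which the denominators of [hl_term] lack. *)
Definition hl_num m n r (x : 'I_n -> {mps L[m]}) : {mps L[m]} :=
  (\prod_(i < n | (i < r)%N) mps_subst (a i) (fun=> x i)) *
  (\prod_(i < n | (i < r)%N) \prod_(j < n | (i < j)%N) fgl_add C (x i) (x j)) *
  \prod_(i < n | ~~ (i < r)%N) \prod_(j < n | (i < j)%N) (x j - x i).

Lemma vdm_neq0 m n (x : 'I_n -> {mps L[m]}) : injective x -> vdm x != 0.
Proof.
move=> xinj; apply/prodf_neq0 => i _; apply/prodf_neq0 => j ij.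
by rewrite subr_eq0 (inj_eq xinj) -val_eqE /= gtn_eqF.
Qed.

Lemma hl_termE m n r (x : 'I_n -> {mps L[m]}) : injective x ->
  hl_term r x = (hl_num r x)%:F / (vdm x)%:F.
Proof.
move=> xinj; apply/(canRL (mulfK _)); first by rewrite tofrac_eq0 vdm_neq0.
have vE : vdm x =
    (\prod_(i < n | (i < r)%N) \prod_(j < n | (i < j)%N) (x j - x i)) *
    \prod_(i < n | ~~ (i < r)%N) \prod_(j < n | (i < j)%N) (x j - x i).
  by rewrite /vdm (bigID (fun i : 'I_n => (i < r)%N)).
rewrite /hl_term /hl_num.
rewrite {}vE !tofracM mulrA -[X in X * _]mulrA; congr (_ * _ * _).
  by rewrite rmorph_prod.
rewrite !rmorph_prod -big_split /=; apply: eq_bigr => i _.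
rewrite !rmorph_prod -big_split /=; apply: eq_bigr => j ij.
by rewrite divfK // tofrac_eq0 subr_eq0 (inj_eq xinj) -val_eqE /= gtn_eqF.
Qed.

Lemma hl_term_perm m n r (x : 'I_n -> {mps L[m]}) (s : 'S_n) :
  (forall i : 'I_n, (i < r)%N -> s i = i) -> hl_term r (x \o s) = hl_term r x.
Proof.
move=> sr; rewrite /hl_term; congr (_ * _).
  by apply: eq_bigr => i ir; rewrite /= sr.
apply: eq_bigr => i ir; rewrite [RHS](reindex_inj (@perm_inj _ s)) /=.
(* If t j <= i < r then t fixes t j, so j = t j by injectivity. Hence reindexing by s preserves the
   range j > i. *)
have sle (t : 'S_n) (j : 'I_n) : (forall i : 'I_n, (i < r)%N -> t i = i) ->
    (t j <= i)%N -> (j <= i)%N.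
  move=> tr tj; suff -> : j = t j by [].
  by apply: (@perm_inj _ t); rewrite [in RHS]tr ?(leq_ltn_trans tj).
apply: eq_big => j; last by rewrite sr.
rewrite !ltnNge; congr (~~ _); apply/idP/idP => [ji|]; last exact: sle.
by rewrite sr // (leq_ltn_trans ji).
Qed.

(** * Integrality: the symmetrized fraction is a power series *)

Section Existence.
Variables (n r : nat).
Hypothesis rn : (r <= n)%N.

Let X : 'I_n -> {mps L[n]} := mpsX.
Let Xinj : injective X. Proof. exact: mpsX_inj. Qed.
Let altsum := \sum_(w : 'S_n) (-1) ^+ w * hl_num r (X \o w).

Lemma hl_term_vdm (w : 'S_n) :
  hl_term r (X \o w) = ((-1) ^+ w * hl_num r (X \o w))%:F / (vdm X)%:F.
Proof.
rewrite hl_termE; last by apply: inj_comp => //; apply: perm_inj.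
rewrite vdm_perm !tofracM rmorph_sign invfM invr_sign.
by rewrite mulrCA mulrA.
Qed.

(** The signed numerators are invariant under the permutations of the indices i >= r, a group of
    order (n-r)!. *)
Lemma alternating_sum_divisible : exists h, altsum = h *+ (n - r)`!.
Proof.
pose A : {set 'I_n} := [set i : 'I_n | ~~ (i < r)%N]%SET.
have [s w|h Eh] := @sum_coset_invariant {perm 'I_n} _ (Sym_group A)
  (fun w => (-1) ^+ w * hl_num r (X \o w)); last first.
  exists h; rewrite /altsum Eh card_Sym; congr (_ *+ _`!).
  by rewrite cardsE card_ord_geq.
rewrite inE => sA.
apply/eqP; rewrite -tofrac_eq.
(* Divided by [vdm X], both sides become values of [hl_term], whose invariance is [hl_term_perm]. *)
apply/eqP/(mulIf (_ : ((vdm X)%:F)^-1 != 0)).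
  by rewrite invr_eq0 tofrac_eq0 vdm_neq0.
rewrite -!hl_term_vdm.
have -> : X \o (s * w)%g = (X \o w) \o s by apply/funext => i /=; rewrite permM.
by apply: hl_term_perm => i ir; apply: (out_perm sA); rewrite inE ir.
Qed.

(** Once x_i = x_j, composing w with the transposition of i and j keeps the numerator and flips the
    sign; the sum equals its opposite, hence is 0 in characteristic zero. *)
Lemma alternating_sum_vanishes i j : i != j ->
  mps_subst altsum (replaceX i (mpsX j)) = 0.
Proof.
move=> ij; pose e := replaceX i (mpsX j : {mps L[n]}).
have e1 k : ordge 1 (e k) by apply: replaceX_ordge; apply: mpsX_ordge.
have X1 k : ordge 1 (X k) by apply: mpsX_ordge.
have numE (x : 'I_n -> {mps L[n]}) : (forall k, ordge 1 (x k)) ->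
    mps_subst (hl_num r x) e = hl_num r (fun k => mps_subst (x k) e).
  move=> x1; rewrite -[LHS]/(msubst e1 _) /hl_num !rmorphM !rmorph_prod.
  congr (_ * _ * _); apply: eq_bigr => k _.
  - by rewrite [LHS]mps_subst_comp.
  - by rewrite rmorph_prod; apply: eq_bigr => l _; rewrite [LHS]fgl_add_subst.
  - by rewrite rmorph_prod; apply: eq_bigr => l _; rewrite rmorphB.
have SE : mps_subst altsum e = \sum_(w : 'S_n) (-1) ^+ w * hl_num r (e \o w).
  rewrite -[LHS]/(msubst e1 _) rmorph_sum; apply: eq_bigr => w _.
  rewrite rmorphM rmorph_sign; congr (_ * _); rewrite [LHS]numE; last first.
    by move=> k; apply: X1.
  by congr hl_num; apply/funext => k /=; rewrite mps_substX.
have SN : mps_subst altsum e = - mps_subst altsum e.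
  apply: (etrans SE); rewrite (reindex_inj (mulIg (tperm i j))) SE -sumrN.
  apply: eq_bigr => w _.
  rewrite odd_permM odd_tperm ij addbT signrN mulNr.
  congr (- (_ * _)); congr hl_num.
  apply/funext => k; rewrite /= permM /e /replaceX; case: tpermP => [->|->|//].
    by rewrite eqxx eq_sym (negPf ij).
  by rewrite eqxx eq_sym (negPf ij).
apply: (@mps_char0 _ _ 1); rewrite mulr2n {1}SN addNr //.
Qed.

(** The factors are divided out one pair at a time: setting x_i = x_j kills h but none of the
    factors already removed, so it kills the remaining quotient. *)
Lemma vdm_dvd (h : {mps L[n]}) :
  (forall i j : 'I_n, (i < j)%N -> mps_subst h (replaceX i (mpsX j)) = 0) ->
  exists p, h = vdm X * p.
Proof.
move=> h0; rewrite /vdm pair_big_dep /=.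
pose P (u : 'I_n * 'I_n) := (u.1 < u.2)%N.
rewrite -big_filter; set s := filter _ _.
have : uniq s by rewrite filter_uniq // index_enum_uniq.
have : all P s by rewrite filter_all.
elim: s => [|[i j] s IH] /=; first by exists h; rewrite big_nil mul1r.
move=> /andP[ij sP] /andP[ijs us]; have [p Ep] := IH sP us.
pose e := replaceX i (mpsX j : {mps L[n]}).
have e1 k : ordge 1 (e k) by apply: replaceX_ordge; apply: mpsX_ordge.
have neij : i != j by rewrite -val_eqE /= ltn_eqF.
have [q Eq] : exists q, p = (mpsX i - mpsX j) * q.
  apply: mps_dvdXB => //; apply/eqP.
  have /eqP : mps_subst h e = 0 by apply: h0.
  rewrite Ep mps_substM // mulf_eq0 => /orP[|//].
  rewrite -[mps_subst _ _]/(msubst e1 _) rmorph_prod prodf_seq_eq0.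
  move=> /hasP[[k l] kls] /=; rewrite rmorphB subr_eq0 /= /msubst.
  rewrite !mps_substX // /e /replaceX.
  have /(allP sP) /= kl := kls.
  (* A factor x_l - x_k can die under x_i := x_j only for (k, l) = (i, j), a pair absent from s; the
     other cases contradict k < l or i < j. *)
  move/eqP; case: (l =P i) => [li|_]; case: (k =P i) => [ki|_].
  - by move: kl; rewrite /P /= li ki ltnn.
  - move/mpsX_inj => jk; move: kl ij; rewrite /P /= li -jk.
    by move=> /ltn_trans lt_trans /lt_trans; rewrite ltnn.
  - by move/mpsX_inj => lj; rewrite ki lj (negPf ijs) in kls.
  - by move/mpsX_inj => lk; move: kl; rewrite /P /= lk ltnn.
(* The sign accounts for x_j - x_i in [vdm] against x_i - x_j in [mps_dvdXB]. *)
exists (- q); rewrite big_cons /= Ep Eq /X.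
by rewrite mulrN -mulNr -mulNr opprB [LHS]mulrCA mulrA.
Qed.

(** With the alternating sum equal to (n-r)! h, characteristic zero passes its vanishing at x_i =
    x_j on to h, so [vdm X] divides h and both denominators cancel. *)
Lemma hl_frac_series : exists p : {mps L[n]}, p%:F = hl_frac n r.
Proof.
have [h Eh] := alternating_sum_divisible.
have [p Ep] : exists p, h = vdm X * p.
  apply: vdm_dvd => i j ij; have neij : i != j by rewrite -val_eqE /= ltn_eqF.
  have := alternating_sum_vanishes neij; rewrite Eh.
  have e1 k : ordge 1 (replaceX i (mpsX j : {mps L[n]}) k).
    by apply: replaceX_ordge; apply: mpsX_ordge.
  rewrite -[LHS]/(msubst e1 _) rmorphMn -(prednK (fact_gt0 _)).
  exact: mps_char0.
exists p; rewrite /hl_frac.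
have -> : \sum_(w : 'S_n) hl_term r (fun i => mpsX (w i)) =
    altsum%:F / (vdm X)%:F.
  rewrite /altsum rmorph_sum mulr_suml; apply: eq_bigr => w _.
  exact: hl_term_vdm.
rewrite Eh Ep tofracMn tofracM -[_ * _ *+ _]mulr_natl -[_ * _ / _]mulrA.
rewrite mulKf ?tofrac_fact_neq0 // mulrAC divff ?mul1r //.
by rewrite tofrac_eq0 vdm_neq0.
Qed.

End Existence.

(** * Setting the last variable to 0 *)

Section Restriction.
Hypothesis C_0 : forall m (b : {mps L[m]}), ordge 1 b -> fgl_add C b 0 = - b.
Variables n r : nat.
Hypothesis a_0 : forall i, (i < r)%N -> ordge 1 (a i).

Definition last0 : 'I_n.+1 -> {mps L[n]} :=
  fun i => if unlift ord_max i is Some j then mpsX j else 0.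

Lemma last0_ordge i : ordge 1 (last0 i).
Proof.
by rewrite /last0; case: unliftP => *; [apply: mpsX_ordge|apply: ordge0].
Qed.

(** Injectivity keeps every denominator x_j - x_i non-zero after the specialization. *)
Lemma last0_inj : injective last0.
Proof.
move=> i j; rewrite /last0.
case: unliftP => [i' ->|->]; case: unliftP => [j' ->|->] //.
- by move/mpsX_inj ->.
- by move/eqP; rewrite (negPf (mpsX_neq0 _ _)).
- by move/esym/eqP; rewrite (negPf (mpsX_neq0 _ _)).
Qed.

Lemma specializes_hl_term (w : 'S_n.+1) :
  specializes (msubst last0_ordge) (hl_term r (fun i => mpsX (w i)))
    (hl_term r (last0 \o w)).
Proof.
have X1 i : ordge 1 (mpsX i : {mps L[n.+1]}) by apply: mpsX_ordge.
have lX i : msubst last0_ordge (mpsX i) = last0 i.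
  exact: (mps_substX last0_ordge).
apply: specializesM; apply: specializes_prod => i ir.
  have -> : mps_subst (a i) (fun=> (last0 \o w) i) =
      msubst last0_ordge (mps_subst (a i) (fun=> mpsX (w i))).
    rewrite /msubst mps_subst_comp //; last exact: last0_ordge.
    by apply: eq_mps_subst => k; apply/esym/(mps_substX last0_ordge).
  exact: specializes_tofrac.
apply: specializes_prod => j ij.
have <- : msubst last0_ordge (fgl_add C (mpsX (w i)) (mpsX (w j))) =
    fgl_add C ((last0 \o w) i) ((last0 \o w) j).
  rewrite [LHS]fgl_add_subst //; last exact: last0_ordge.
  by congr fgl_add; apply: lX.
rewrite /= -!lX -rmorphB; apply: specializes_frac.
rewrite [X in X != 0](_ : _ = last0 (w j) - last0 (w i)); last first.
  by rewrite [LHS]msubst_additive !lX.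
rewrite subr_eq0 (inj_eq last0_inj) (inj_eq (@perm_inj _ w)).
by rewrite -val_eqE /= gtn_eqF.
Qed.

Lemma lift_lt (k : 'I_n.+1) (i : 'I_n) : (r <= k)%N ->
  (lift k i < r)%N = (i < r)%N.
Proof.
move=> rk; rewrite /= /bump; have [ki|//] := leqP k i.
by rewrite add1n !ltnNge (leq_trans rk ki) (leqW (leq_trans rk ki)).
Qed.

Lemma hl_term_last0 (k : 'I_n.+1) (s : 'S_n) :
  hl_term r (last0 \o lift_perm k ord_max s) =
  if (k < r)%N then 0 else hl_term r (fun i => mpsX (s i)).
Proof.
pose y := last0 \o lift_perm k ord_max s.
have yk : y k = 0 by rewrite /y /= lift_perm_id /last0 unlift_none.
have yl i : y (lift k i) = mpsX (s i).
  by rewrite /y /= lift_perm_lift /last0 liftK.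
case: ltnP => [kr|rk].
  rewrite /hl_term (bigD1 k) //= -/y.
  rewrite -[X in (fun=> X)]/(y k) yk.
  by rewrite mps_subst_at0 ?tofrac0 ?mul0r //; apply: a_0.
have knr : ~~ (k < r)%N by rewrite -leqNgt.
pose P (i : 'I_n.+1) := (i < r)%N.
rewrite /hl_term -/y !(@big_lift_notin _ _ k P) //.
congr (_ * _).
  apply: eq_big => [i|i]; first exact: lift_lt.
  (* As i < r <= k, lifting past k leaves the index i of [a i] unchanged. *)
  rewrite /P lift_lt // => ir; rewrite yl /= /bump.
  by rewrite leqNgt (leq_trans ir rk).
apply: eq_big => [i|i ir0]; first exact: lift_lt.
(* Position k, which carries the value 0, comes after every i < r, so each inner product contains
   the factor j = k. *)
have ik : (lift k i < k)%N by exact: leq_trans ir0 rk.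
rewrite (bigD1_ord k) //= yl yk C_0; last exact: mpsX_ordge.
rewrite sub0r divff ?mul1r; last by rewrite tofrac_eq0 oppr_eq0 mpsX_neq0.
by apply: eq_big => [j|j _]; [rewrite /= !ltnNge leq_bump2|rewrite !yl].
Qed.

Lemma hl_frac_restrict (p : {mps L[n.+1]}) : (r <= n.+1)%N ->
  p%:F = hl_frac n.+1 r ->
  (mps_last0 p)%:F = if (r <= n)%N then hl_frac n r else 0.
Proof.
move=> rn pE; have fN0 := tofrac_fact_neq0 n.+1 (n.+1 - r).
have fn0 := tofrac_fact_neq0 n (n.+1 - r).
have pS : (p *+ (n.+1 - r)`!)%:F =
    \sum_(w : 'S_n.+1) hl_term r (fun i => mpsX (w i)).
  by rewrite tofracMn pE /hl_frac -[_ * _ *+ _]mulr_natl mulVKf.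
have : specializes (msubst last0_ordge) (p *+ (n.+1 - r)`!)%:F
    (\sum_(w : 'S_n.+1) hl_term r (last0 \o w)).
  by rewrite pS; apply: specializes_sum => w _; apply: specializes_hl_term.
move/specializes_inj; rewrite (sum_lift_perm ord_max) => E0.
apply: (mulfI fn0); rewrite mulr_natl -tofracMn.
rewrite -[mps_last0 p]/(msubst last0_ordge p).
rewrite -(rmorphMn (msubst last0_ordge)) -{}E0.
under eq_bigr do under eq_bigr do rewrite hl_term_last0.
(* Exactly n + 1 - r positions k >= r survive, each giving the same sum over ['S_n]. This count
   turns (n+1-r)! into (n-r)!, and it is 0 when r = n + 1. *)
have -> : \sum_(k < n.+1) \sum_(s : 'S_n) (if (k < r)%N then 0
    else hl_term r (fun i : 'I_n => mpsX (s i))) =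
    (n.+1 - r)%:R * \sum_(s : 'S_n) hl_term r (fun i : 'I_n => mpsX (s i)).
  rewrite mulr_natl -(card_ord_geq rn) -sumr_const [RHS]big_mkcond /=.
  apply: eq_bigr => k _; rewrite [in RHS]inE /=.
  by case: (k < r)%N => //=; rewrite big1.
case: ifP => [rn1|/negbT]; last first.
  rewrite -ltnNge => nr.
  have -> : (n.+1 - r = 0)%N by apply/eqP; rewrite subn_eq0.
  by rewrite mul0r mulr0.
rewrite subSn // factS natrM -mulrA /hl_frac; congr (_ * _).
by rewrite mulrA mulfV ?mul1r // tofrac_fact_neq0.
Qed.

End Restriction.
End HallLittlewoodSum.

(** * Characteristic zero of the Lazard ring, and the cases P and Q *)

Lemma additive_is_fgl (R : comNzRingType) :
  is_fgl (mpsX ord0 + mpsX ord_max : {mps R[2]}).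
Proof.
have addE n (a b : {mps R[n]}) : ordge 1 a -> ordge 1 b ->
    fgl_add (mpsX ord0 + mpsX ord_max) a b = a + b.
  by move=> a1 b1; rewrite /fgl_add !(fgl_addE a1 b1).
have X1 n (i : 'I_n) : ordge 1 (mpsX i : {mps R[n]}) by apply: mpsX_ordge.
have z1 n : ordge 1 (0 : {mps R[n]}) by apply: ordge0.
split=> [|||u v w]; first by rewrite addE // addr0.
- by rewrite addE // add0r.
- by rewrite /= !addE // addrC.
have [u1 v1 w1] : [/\ ordge 1 u, ordge 1 v & ordge 1 w] by split; apply: X1.
by rewrite !addE ?addrA //; apply: ordgeD.
Qed.

(** Classifying the additive law over [int] yields a ring morphism from L to [int], under which k +
    1 stays non-zero. *)
Lemma universal_fgl_char0 (L : comNzRingType) (F : {mps L[2]}) :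
  universal_fgl F -> forall k, (k.+1)%:R != 0 :> L.
Proof.
move=> [_ /(_ int _ (additive_is_fgl int))[[phi _] _]] k.
apply/eqP => /(congr1 phi); rewrite rmorph_nat rmorph0 => /eqP.
by rewrite Num.Theory.pnatr_eq0.
Qed.

Section Specialize.
Variables (L : idomainType) (F : {mps L[2]}).
Local Notation "x %:F" := (tofrac x).

Lemma series_of_fracE n (p : {mps L[n]}) : series_of_frac p%:F = p.
Proof.
rewrite /series_of_frac; case: xgetP => [q _ /= /eqP|/(_ p)/= []//].
by rewrite tofrac_eq => /eqP.
Qed.

Lemma hl_series_restrict (C : {mps L[2]}) (a : nat -> {mps L[1]}) r n :
  (forall k, (k.+1)%:R != 0 :> L) ->
  (forall m (b : {mps L[m]}), ordge 1 b -> fgl_add C b 0 = - b) ->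
  (forall i, (i < r)%N -> ordge 1 (a i)) -> (r <= n.+1)%N ->
  mps_last0 (series_of_frac (hl_frac C a n.+1 r)) =
  if (r <= n)%N then series_of_frac (hl_frac C a n r) else 0.
Proof.
move=> L0 C0 a0 rn; have [p pE] := hl_frac_series C a L0 rn.
have pr := hl_frac_restrict L0 C0 a0 rn pE.
rewrite -pE series_of_fracE; case: ifP pr => _ pr.
  by rewrite -pr series_of_fracE.
by apply/eqP; rewrite -tofrac_eq pr rmorph0.
Qed.

Hypothesis F0r : fgl_add F (mpsX ord0) 0 = mpsX ord0 :> {mps L[1]}.
Hypothesis F0l : fgl_add F 0 (mpsX ord0) = mpsX ord0 :> {mps L[1]}.

Definition P_series (la : seq nat) i : {mps L[1]} := mpsX ord0 ^+ nth 0%N la i.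

Definition Q_series (la : seq nat) i : {mps L[1]} :=
  fgl_add F (mpsX ord0) (mpsX ord0) * mpsX ord0 ^+ (nth 0%N la i).-1.

Let X1 n i : ordge 1 (mpsX i : {mps L[n]}). Proof. exact: mpsX_ordge. Qed.

Lemma P_series_ordge la i : strict_partition la -> (i < size la)%N ->
  ordge 1 (P_series la i).
Proof.
move=> /andP[_ la0] il; rewrite /P_series -(@prednK (nth 0%N la i)).
  by rewrite exprS; apply: ordgeMr.
by rewrite lt0n; apply: contra la0 => /eqP <-; apply: mem_nth.
Qed.

Lemma Q_series_ordge la i : ordge 1 (Q_series la i).
Proof.
have [H FH] := fgl_add_expansion F0r F0l.
(* The factor x +_F x has no constant term, which covers a part equal to 1, where the power of x is
   trivial. *)
apply: ordgeMr; rewrite FH //.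
by apply: ordgeD; [apply: ordgeD|do 2 apply: ordgeMr].
Qed.

Section Quotient.
Variable C : {mps L[2]}.
Hypothesis FC : forall n (a b : {mps L[n]}), ordge 1 a -> ordge 1 b -> a != b ->
  (fgl_add F a b)%:F / (fgl_add F a (fgl_opp F b))%:F =
  (fgl_add C a b)%:F / (b - a)%:F.

Lemma cross_factorE n r (w : 'S_n) :
  cross_factor F r (fun i => mpsX (w i)) =
  \prod_(i < n | (i < r)%N) \prod_(j < n | (i < j)%N)
    ((fgl_add C (mpsX (w i)) (mpsX (w j)))%:F /
     (mpsX (w j) - mpsX (w i) : {mps L[n]})%:F).
Proof.
apply: eq_bigr => i _; apply: eq_bigr => j ij; apply: FC => //.
rewrite (inj_eq (@mpsX_inj _ _)) (inj_eq (@perm_inj _ w)) -val_eqE /=.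
by rewrite ltn_eqF.
Qed.

Lemma P_fracE n la : P_frac F n la = hl_frac C (P_series la) n (size la).
Proof.
congr (_ * _); apply: eq_bigr => w _ /=; rewrite cross_factorE; congr (_ * _).
apply: eq_bigr => i _; congr tofrac.
by rewrite /P_series mps_substXn ?mps_substX.
Qed.

Lemma Q_fracE n la : Q_frac F n la = hl_frac C (Q_series la) n (size la).
Proof.
congr (_ * _); apply: eq_bigr => w _ /=; rewrite cross_factorE; congr (_ * _).
apply: eq_bigr => i _; congr tofrac.
by rewrite /Q_series mps_substM ?mps_substXn ?fgl_add_subst ?mps_substX.
Qed.

End Quotient.
End Specialize.

Theorem proposition4p7 (L : idomainType) (F : {mps L[2]})
    (hF : universal_fgl F) (n : nat) (la : seq nat)
    (hla : strict_partition la) (hr : (size la <= n.+1)%N) :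
  mps_last0 (P_fun F n.+1 la) = P_fun F n la /\
  mps_last0 (Q_fun F n.+1 la) = Q_fun F n la.
Proof.
have L0 := universal_fgl_char0 hF; have [[F0r F0l _ _] _] := hF.
have [C [FC C0]] := fgl_quotient F0r F0l.
rewrite /P_fun /Q_fun hr !(P_fracE FC) !(Q_fracE FC).
split; apply: hl_series_restrict => // i il; first exact: P_series_ordge.
exact: Q_series_ordge.
Qed.
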